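(* For all $a\in\mathbb{N}$, $b\in\mathbb{N}_+$ and $0\le k\le a$, $$c(a,b,k)=|P_k[[1,a]],\omega_b|=\sum_{A\in P_k[[1,a]]}\omega_b(A).$$ That is, $$c(a,b,k)=[b]^{(k)}\,q^{(a-k)b}\sum_{A\in P_k[[1,a]]}q^{\sum_{i\in A^c}|A_{<i}|}.$$
   Context: $\mathbb{N}=\{0,1,2,\dots\}$ and $\mathbb{N}_+=\{1,2,\dots\}$. The $q$-meromorphic Weyl algebra is $MW_q=\mathbb{C}\langle x,y\rangle[q]/\langle yx-qxy-x^2\rangle$, where $\mathbb{C}\langle x,y\rangle[q]$ is the free associative complex algebra in the non-commuting variables $x,y$ with an adjoined formal variable $q$ that commutes with everything. The monomials $q^ix^jy^l$ ($i,j,l\in\mathbb{N}$) form a $\mathbb{C}$-basis of $MW_q$. For $a,b\in\mathbb{N}$ and $0\le k\le a$, the normal coordinates $c(a,b,k)\in\mathbb{N}[q]$ are defined by the identity in $MW_q$ $$y^ax^b=\sum_{k=0}^a c(a,b,k)x^{b+k}y^{a-k}.$$ Put $[n]=1+q+\cdots+q^{n-1}$ for $n\ge1$, and $[b]^{(k)}=[b][b+1]\cdots[b+k-1]$ (equal to $1$ if $k=0$). $[[1,a]]=\{1,\dots,a\}$ (empty if $a=0$), and $P_k[[1,a]]$ is the set of $k$-element subsets of $[[1,a]]$. For $A\in P_k[[1,a]]$, $A^c=[[1,a]]\setminus A$ and $A_{<i}=\{j\in A: j<i\}$. The weight $\omega_b:P_k[[1,a]]\to\mathbb{N}[q]$ is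 $$\omega_b(A)=[b]^{(k)}q^{(a-k)b}q^{\sum_{i\in A^c}|A_{<i}|}.$$ For a finite set $S$ with a map $\omega:S\to\mathbb{N}[q]$, the cardinality of the pair is $|S,\omega|=\sum_{s\in S}\omega(s)\in\mathbb{N}[q]$. *)

(* Defs.v *)
From HB Require Import structures.
From mathcomp Require Import all_boot all_order all_algebra.
From mathcomp Require Import generic_quotient ring_quotient.
From mathcomp Require Import boolp reals.
From mathcomp Require Import complex.
From mathcomp.multinomials Require Import monalg.

Set Implicit Arguments.
Unset Strict Implicit.
Unset Printing Implicit Defensive.

Import GRing.Theory.

Local Open Scope ring_scope.
Local Open Scope quotient_scope.

(* The library makes {quot I} a ring only when the ambient ring is commutative;
   the noncommutative case is built here, for the two-sided ideal generated by
   one relator.  Ideal membership is made Boolean by [asbool]. *)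
Section QuotientByRelator.
Variables (A : nzRingType) (r : A).

Definition ideal_gen : {pred A} :=
  fun p => `[< exists s : seq (A * A), p = \sum_(u <- s) u.1 * r * u.2 >].

Lemma ideal_genP p :
  reflect (exists s : seq (A * A), p = \sum_(u <- s) u.1 * r * u.2)
          (p \in ideal_gen).
Proof. exact: asboolP. Qed.

Fact ideal_gen_zmod_closed : zmod_closed ideal_gen.
Proof.
split=> [|p p' /ideal_genP[s ->] /ideal_genP[s' ->]].
  by apply/ideal_genP; exists [::]; rewrite big_nil.
apply/ideal_genP; exists (s ++ [seq (- u.1, u.2) | u <- s']).
rewrite big_cat big_map /= -sumrN; congr (_ + _).
by apply: eq_bigr => u _; rewrite !mulNr.
Qed.

HB.instance Definition _ := GRing.isZmodClosed.Build A ideal_gen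
  ideal_gen_zmod_closed.

Lemma ideal_genMl u p : p \in ideal_gen -> u * p \in ideal_gen.
Proof.
move=> /ideal_genP[s ->]; apply/ideal_genP.
exists [seq (u * v.1, v.2) | v <- s]; rewrite big_map mulr_sumr.
by apply: eq_bigr => v _; rewrite /= !mulrA.
Qed.

Lemma ideal_genMr u p : p \in ideal_gen -> p * u \in ideal_gen.
Proof.
move=> /ideal_genP[s ->]; apply/ideal_genP.
exists [seq (v.1, v.2 * u) | v <- s]; rewrite big_map mulr_suml.
by apply: eq_bigr => v _; rewrite /= !mulrA.
Qed.

Definition rel_quot := Quotient.quot ideal_gen.
HB.instance Definition _ := EqQuotient.on rel_quot.
HB.instance Definition _ := GRing.Zmodule.on rel_quot.

Lemma rel_quot_eq p p' :
  (\pi_rel_quot p == \pi_rel_quot p') = (p - p' \in ideal_gen).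
Proof. by rewrite -Quotient.idealrBE. Qed.

Definition rel_quot_one : rel_quot := lift_cst rel_quot 1.
Definition rel_quot_mul := lift_op2 rel_quot *%R.

Lemma pi_mulM p p' :
  \pi_rel_quot (p * p') = rel_quot_mul (\pi_rel_quot p) (\pi_rel_quot p').
Proof.
rewrite /rel_quot_mul -lock; apply/eqP; rewrite rel_quot_eq; set u := repr _; set v := repr _.
have -> : p * p' - u * v = (p - u) * p' + u * (p' - v).
  by rewrite mulrBl mulrBr addrA subrK.
by apply: rpredD; [apply: ideal_genMr | apply: ideal_genMl];
  rewrite -rel_quot_eq reprK.
Qed.

Fact rel_quot_mulA : associative rel_quot_mul.
Proof.
by move=> u v w; rewrite -[u]reprK -[v]reprK -[w]reprK -!pi_mulM mulrA.
Qed.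

Fact rel_quot_1mul : left_id rel_quot_one rel_quot_mul.
Proof. by move=> u; rewrite /rel_quot_one -lock -[u]reprK -pi_mulM mul1r. Qed.

Fact rel_quot_mul1 : right_id rel_quot_one rel_quot_mul.
Proof. by move=> u; rewrite /rel_quot_one -lock -[u]reprK -pi_mulM mulr1. Qed.

Lemma pi_addD p p' :
  \pi_rel_quot (p + p') = \pi_rel_quot p + \pi_rel_quot p'.
Proof. exact: Quotient.pi_add. Qed.

Fact rel_quot_mulDl : left_distributive rel_quot_mul +%R.
Proof.
move=> u v w; rewrite -[u]reprK -[v]reprK -[w]reprK.
by rewrite -!(pi_addD, pi_mulM) mulrDl.
Qed.

Fact rel_quot_mulDr : right_distributive rel_quot_mul +%R.
Proof.
move=> u v w; rewrite -[u]reprK -[v]reprK -[w]reprK.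
by rewrite -!(pi_addD, pi_mulM) mulrDr.
Qed.

HB.instance Definition _ := GRing.Zmodule_isPzRing.Build rel_quot
  rel_quot_mulA rel_quot_1mul rel_quot_mul1 rel_quot_mulDl rel_quot_mulDr.

Definition rel_proj (p : A) : rel_quot := \pi_rel_quot p.

Lemma rel_projE p p' : (rel_proj p == rel_proj p') = (p - p' \in ideal_gen).
Proof. exact: rel_quot_eq. Qed.

Fact rel_proj_is_zmod_morphism : zmod_morphism rel_proj.
Proof.
move=> p p'; apply/eqP; rewrite -(inj_eq (addIr (rel_proj p'))) subrK.
by rewrite -[_ + _]pi_addD subrK.
Qed.

Fact rel_proj_is_monoid_morphism : monoid_morphism rel_proj.
Proof.
split; last exact: pi_mulM.
by rewrite /rel_proj -[1 in RHS]/rel_quot_one /rel_quot_one -lock.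
Qed.

HB.instance Definition _ := GRing.isZmodMorphism.Build A rel_quot rel_proj
  rel_proj_is_zmod_morphism.
HB.instance Definition _ := GRing.isMonoidMorphism.Build A rel_quot rel_proj
  rel_proj_is_monoid_morphism.

End QuotientByRelator.

Section MeromorphicWeyl.
Variable R : realType.

(* C<x, y>: the monoid algebra over C = R[i] of the free monoid on two letters,
   [false] standing for x and [true] for y. *)
Definition free_alg : nzRingType := {malg R[i][{fmonom bool}]}.

Definition free_x : free_alg := mkmalgU (fmu false) 1.
Definition free_y : free_alg := mkmalgU (fmu true) 1.

(* In C<x, y>[q] the variable q is 'X, which is central. *)
Definition mw_relator : {poly free_alg} :=
  free_y%:P * free_x%:P - 'X * (free_x%:P * free_y%:P) - free_x%:P ^+ 2.

Local Notation MW := (rel_quot mw_relator).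

Definition mw_x : MW := rel_proj mw_relator free_x%:P.
Definition mw_y : MW := rel_proj mw_relator free_y%:P.

(* The image in MW of an element of N[q]. *)
Definition mw_coef (c : {poly nat}) : MW :=
  rel_proj mw_relator (map_poly (fun n : nat => n%:R : free_alg) c).

(* Only the values [c k] with k <= a are relevant. *)
Definition normal_coords (a b : nat) (c : nat -> {poly nat}) : Prop :=
  mw_y ^+ a * mw_x ^+ b =
  \sum_(k < a.+1) mw_coef (c k) * mw_x ^+ (b + k) * mw_y ^+ (a - k).

End MeromorphicWeyl.

Definition qint (n : nat) : {poly nat} := \sum_(i < n) 'X^i.

Definition qrising (b k : nat) : {poly nat} := \prod_(i < k) qint (b + i).

(* [[1, a]], as a set of elements of 'I_a.+1 = {0, ..., a}. *)
Definition interval1 (a : nat) : {set 'I_a.+1} := [set i : 'I_a.+1 | (0 < i)%N].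

Definition ksubsets (a k : nat) : {set {set 'I_a.+1}} :=
  [set A : {set 'I_a.+1} | (A \subset interval1 a) && (#|A| == k)].

Definition qexponent (a : nat) (A : {set 'I_a.+1}) : nat :=
  (\sum_(i in interval1 a :\: A) #|[set j in A | (j < i)%N]|)%N.

(* The k of the formula is #|A| when A is in [ksubsets a k]. *)
Definition weight (a b k : nat) (A : {set 'I_a.+1}) : {poly nat} :=
  qrising b k * 'X^((a - k) * b) * 'X^(qexponent A).

Definition wcard (T : finType) (S : {set T}) (w : T -> {poly nat}) :
  {poly nat} := \sum_(s in S) w s.

(* Main.v *)
Require Import Defs.
From mathcomp Require Import all_boot all_order all_algebra.
From mathcomp Require Import reals.
From HB Require Import structures.
From mathcomp Require Import complex ring.
From mathcomp.multinomials Require Import monalg.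

Set Implicit Arguments.
Unset Strict Implicit.
Unset Printing Implicit Defensive.

Import GRing.Theory.

Local Open Scope ring_scope.

(** The claimed coordinates are correct because they obey the recurrence that
    multiplication by y forces, and they are the only ones because the
    monomials x^i y^j are independent over C[q].

    Existence.  The relation y x = q x y + x^2 gives, by induction on n,
        y x^n = q^n x^n y + [n] x^(n+1)           ([mul_y_xn]).
    Multiplying the normal form of y^a x^b by y on the left therefore yields
        c(a+1, b, k+1) = [b+k] c(a, b, k) + q^(b+k+1) c(a, b, k+1).
    On the combinatorial side, let S(a, k) be the sum of
    q^(sum over i in A^c of |A_(<i)|) over the k-subsets A of [[1, a]].  Whether
    a + 1 belongs to a (k+1)-subset of [[1, a+1]] splits the sum: if it does, it
    contributes nothing to the exponent; if it does not, it sees all k + 1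
    elements of the subset below it.  Hence
        S(a+1, k+1) = S(a, k) + q^(k+1) S(a, k+1)  ([subset_gfS]),
    and multiplying by [b]^(k) q^((a-k)b) turns this into the recurrence for c
    ([coordS], [mul_yn_xn]).

    Uniqueness.  Let x and y act on the span of the powers X^(s+n), n >= 0, of a
    variable X over C[q], by multiplication by X and by X^2 times the
    q-derivative, that is X^m |-> [m] X^(m+1).  Here s need not be a number: all
    that matters is the scalar z = [s], which is taken to be a new variable, and
    [s+n+1] = q [s+n] + 1.  With e_n = X^(s+n) one gets
        x e_n = e_(n+1),     y e_n = [s+n] e_(n+1),
    so x^i y^j sends e_0 to [s][s+1]...[s+j-1] e_(i+j).  These coefficients are
    polynomials in z of degree exactly j, so for i + j fixed they are linearly
    independent over C[q] ([lin_indep_by_size]).  Only the vectors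
    e_0, ..., e_(a+b) are needed; cutting the action off there makes it a
    representation by matrices over C[q][z], which the universal property of
    the algebra ([mw_universal]) turns into a ring morphism on C<x, y>[q] that
    respects the quotient. *)

(** * The generating function of the exponents *)

Definition subset_gf (a k : nat) : {poly nat} :=
  \sum_(A in ksubsets a k) 'X^(qexponent A).

(** [grow] and [shrink] identify the subsets of [[1, a]] with the subsets of
    [[1, a+1]] that avoid a + 1, which is [ord_max]. *)
Definition grow (a : nat) (A : {set 'I_a.+1}) : {set 'I_a.+2} :=
  [set widen_ord (leqnSn a.+1) i | i in A].

Definition shrink (a : nat) (B : {set 'I_a.+2}) : {set 'I_a.+1} :=
  [set i | widen_ord (leqnSn a.+1) i \in B].

Lemma widen_inj n : injective (widen_ord (leqnSn n)).
Proof. by move=> i j /(congr1 val) /= /val_inj. Qed.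

Lemma mem_grow a (A : {set 'I_a.+1}) i :
  (widen_ord (leqnSn a.+1) i \in grow A) = (i \in A).
Proof. by rewrite mem_imset //; apply: widen_inj. Qed.

Lemma max_grow a (A : {set 'I_a.+1}) : (ord_max \in grow A) = false.
Proof.
apply/negP => /imsetP[i _ /(congr1 val) /= e].
by have := ltn_ord i; rewrite -e ltnn.
Qed.

Lemma ord_maxVwiden n (i : 'I_n.+1) :
  i = ord_max \/ exists j, i = widen_ord (leqnSn n) j.
Proof.
have := ltn_ord i; rewrite ltnS leq_eqVlt => /orP[/eqP e | lt_in].
  by left; apply: val_inj.
by right; exists (Ordinal lt_in); apply: val_inj.
Qed.

Lemma widen_neq_max n (i : 'I_n) : (widen_ord (leqnSn n) i == ord_max) = false.
Proof.
by apply/negP => /eqP/(congr1 val) /= e; have := ltn_ord i; rewrite e ltnn.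
Qed.

Lemma growK a : cancel (@grow a) (@shrink a).
Proof. by move=> A; apply/setP=> i; rewrite inE mem_grow. Qed.

Lemma shrinkK a (B : {set 'I_a.+2}) : ord_max \notin B -> grow (shrink B) = B.
Proof.
move=> /negbTE Bmax; apply/setP=> i.
by have [->|[j ->]] := ord_maxVwiden i; rewrite ?max_grow ?mem_grow ?inE.
Qed.

Lemma ksubsets_grow a k A : (grow A \in ksubsets a.+1 k) = (A \in ksubsets a k).
Proof.
rewrite !inE card_imset; last exact: widen_inj.
congr (_ && _); apply/subsetP/subsetP => AI i Ai.
  by have := AI (widen_ord (leqnSn a.+1) i); rewrite mem_grow !inE; apply.
by case/imsetP: Ai => j Aj ->; have := AI j Aj; rewrite !inE.
Qed.

Lemma ksubsets_growU a k A :
  (ord_max |: grow A \in ksubsets a.+1 k.+1) = (A \in ksubsets a k).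
Proof.
rewrite -ksubsets_grow !inE cardsU1 max_grow add1n eqSS subUset sub1set.
by rewrite inE.
Qed.

(** As a double sum over the whole ordinal type, the exponent can be split at
    its largest index with [big_ord_recr]. *)
Lemma qexponentE a (A : {set 'I_a.+1}) : qexponent A =
  (\sum_(i < a.+1 | (0 < i) && (i \notin A))
     \sum_(j < a.+1 | j \in A) (j < i))%N.
Proof.
apply: eq_big => [i|i _]; first by rewrite !inE andbC.
rewrite -sum1_card big_mkcond [RHS]big_mkcond /=; apply: eq_bigr => j _.
by rewrite !inE; case: (j \in A); case: (j < i)%N.
Qed.

(** The new element a + 1 lies in the complement and above all of A. *)
Lemma qexponent_grow a (A : {set 'I_a.+1}) :
  qexponent (grow A) = (#|A| + qexponent A)%N.
Proof.
rewrite !qexponentE big_mkcond big_ord_recr /= max_grow /= addnC.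
congr (_ + _)%N.
  rewrite big_mkcond big_ord_recr /= max_grow addn0 -sum1_card [RHS]big_mkcond.
  by apply: eq_bigr => i _; rewrite mem_grow /= ltn_ord.
rewrite [RHS]big_mkcond; apply: eq_bigr => i _; rewrite mem_grow /=.
case: ifP => // _.
rewrite big_mkcond big_ord_recr /= max_grow addn0 [RHS]big_mkcond.
by apply: eq_bigr => j _; rewrite mem_grow.
Qed.

Lemma mem_growU a (A : {set 'I_a.+1}) i :
  (widen_ord (leqnSn a.+1) i \in ord_max |: grow A) = (i \in A).
Proof. by rewrite !inE widen_neq_max mem_grow. Qed.

(** The new element a + 1 lies in the subset, below no element of the
    complement. *)
Lemma qexponent_growU a (A : {set 'I_a.+1}) :
  qexponent (ord_max |: grow A) = qexponent A.
Proof.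
rewrite !qexponentE big_mkcond big_ord_recr /= setU11 /= addn0.
rewrite [RHS]big_mkcond; apply: eq_bigr => i _; rewrite mem_growU /=.
case: ifP => // _; rewrite big_mkcond big_ord_recr /= setU11.
rewrite [(a.+1 < i)%N]ltnNge (ltnW (ltn_ord i)) addn0 [RHS]big_mkcond.
by apply: eq_bigr => j _; rewrite mem_growU.
Qed.

Lemma subset_gf_notin a k :
  \sum_(B in ksubsets a.+1 k | ord_max \notin B) 'X^(qexponent B) =
  'X^k * subset_gf a k.
Proof.
rewrite (reindex_onto (@grow a) (@shrink a)) /=; last first.
  by move=> B /andP[_ /shrinkK].
rewrite mulr_sumr; apply: eq_big => [A|A].
  by rewrite ksubsets_grow max_grow growK eqxx !andbT.
rewrite ksubsets_grow => /andP[/andP[Ak _] _]; rewrite qexponent_grow exprD.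
by move: Ak; rewrite inE => /andP[_ /eqP->].
Qed.

Lemma subset_gf_in a k :
  \sum_(B in ksubsets a.+1 k.+1 | ord_max \in B) 'X^(qexponent B) =
  subset_gf a k.
Proof.
rewrite (reindex_onto (fun A => ord_max |: grow A) (@shrink a)) /=; last first.
  move=> B /andP[_ Bm]; apply/setP=> i.
  by have [->|[j ->]] := ord_maxVwiden i; rewrite ?setU11 ?Bm ?mem_growU ?inE.
apply: eq_big => [A|A _]; last by rewrite qexponent_growU.
rewrite ksubsets_growU setU11 andbT; case: (A \in _) => //=.
by apply/eqP/setP=> i; rewrite inE mem_growU.
Qed.

Lemma subset_gf0 a : subset_gf a 0 = 1.
Proof.
rewrite /subset_gf (big_pred1 set0) => [|A]; last first.
  by rewrite !inE cards_eq0 /=; case: eqP => [->|]; rewrite ?sub0set ?andbF.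
by rewrite qexponentE big1 // => i _; rewrite big1 // => j; rewrite inE.
Qed.

Lemma subset_gfS a k :
  subset_gf a.+1 k.+1 = subset_gf a k + 'X^(k.+1) * subset_gf a k.+1.
Proof.
rewrite {1}/subset_gf (bigID (fun B : {set 'I_a.+2} => ord_max \in B)) /=.
by rewrite subset_gf_in subset_gf_notin.
Qed.

Lemma subset_gf_gt a k : (a < k)%N -> subset_gf a k = 0.
Proof.
move=> lt_ak; rewrite /subset_gf big1 // => A; rewrite inE => /andP[AI /eqP Ak].
have := subset_leq_card AI; rewrite Ak leqNgt.
suff -> : #|interval1 a| = a by rewrite lt_ak.
rewrite -sum1_card big_mkcond big_ord_recl !inE /= add0n.
rewrite (eq_bigr (fun=> 1%N)) ?sum1_card ?card_ord // => i _.
by rewrite inE.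
Qed.

(** * The recurrence for the coordinates *)

Definition coord (a b k : nat) : {poly nat} :=
  qrising b k * 'X^((a - k) * b) * subset_gf a k.

Lemma coord_gt a b k : (a < k)%N -> coord a b k = 0.
Proof. by move=> lt_ak; rewrite /coord subset_gf_gt ?mulr0. Qed.

Lemma qrisingS b k : qrising b k.+1 = qrising b k * qint (b + k).
Proof. by rewrite /qrising big_ord_recr. Qed.

Lemma coord0 a b : coord a b 0 = 'X^(a * b).
Proof. by rewrite /coord /qrising big_ord0 subset_gf0 subn0 mul1r mulr1. Qed.

Lemma coordS a b k : (k <= a)%N ->
  coord a.+1 b k.+1 =
  qint (b + k) * coord a b k + 'X^(b + k.+1) * coord a b k.+1.
Proof.
move=> le_ka; rewrite /coord subset_gfS subSS qrisingS mulrDr.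
congr (_ + _); first by ring.
move: le_ka; rewrite leq_eqVlt => /orP[/eqP-> | lt_ka].
  by rewrite (@subset_gf_gt a a.+1) ?mulr0.
by rewrite -(subnSK lt_ka) mulSn !exprD; ring.
Qed.

(** * Normal ordering from the commutation relation *)

(** Only the commutation relation and the centrality of the coefficients matter,
    so the computation is done in an arbitrary ring. *)
Section NormalOrder.
Variables (B : pzRingType) (coef : {rmorphism {poly nat} -> B}) (x y : B).
Hypothesis coef_comm : forall c u, coef c * u = u * coef c.
Hypothesis yx : y * x = coef 'X * (x * y) + x ^+ 2.

Lemma mul_y_xn n :
  y * x ^+ n = coef 'X^n * x ^+ n * y + coef (qint n) * x ^+ n.+1.
Proof.
elim: n => [|n IHn].
  by rewrite /qint big_ord0 rmorph0 expr0 rmorph1 mul0r addr0 mulr1 !mul1r.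
rewrite exprSr mulrA IHn mulrDl -!mulrA yx -exprSr.
rewrite /qint big_ord_recr rmorphD /= [in RHS]mulrDl.
rewrite addrA [RHS]addrAC mulrDr mulrDr -exprD addn2; congr (_ + _ + _).
rewrite [in RHS]exprSr rmorphM -mulrA (mulrA (x ^+ n)) -(coef_comm 'X).
by rewrite -!mulrA.
Qed.

(** Multiplication by y sends the k-th summand of the normal form of y^a x^b to
    one summand where k is unchanged and y gains a power, and one where y is
    absorbed and k is raised. *)
Lemma mul_yn_xn a b : y ^+ a * x ^+ b =
  \sum_(k < a.+1) coef (coord a b k) * x ^+ (b + k) * y ^+ (a - k).
Proof.
elim: a => [|a IHa].
  by rewrite big_ord1 coord0 expr0 rmorph1 addn0 mulr1 !mul1r.
pose kept k := coef ('X^(b + k) * coord a b k) * x ^+ (b + k) * y ^+ (a.+1 - k).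
pose raised k :=
  coef (qint (b + k) * coord a b k) * x ^+ (b + k.+1) * y ^+ (a - k).
have step (k : 'I_a.+1) :
    y * (coef (coord a b k) * x ^+ (b + k) * y ^+ (a - k)) = kept k + raised k.
  rewrite !mulrA -coef_comm -(mulrA _ y) mul_y_xn mulrDr mulrDl.
  rewrite /kept /raised !(mulrC _ (coord a b k)) 2!(rmorphM _ (coord a b k)).
  by rewrite subSn ?leq_ord // (exprS y (a - k)) addnS !mulrA.
rewrite exprS -mulrA IHa mulr_sumr (eq_bigr _ (fun k _ => step k)).
rewrite big_split /= [RHS]big_ord_recl.
(* The sum may be extended to k = a.+1, where the coordinate vanishes. *)
have -> : \sum_(k < a.+1) kept k = kept 0%N + \sum_(k < a.+1) kept k.+1.
  transitivity (\sum_(k < a.+2) kept k); last by rewrite big_ord_recl.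
  rewrite [RHS]big_ord_recr /= [kept a.+1]/kept coord_gt // mulr0.
  by rewrite rmorph0 !mul0r addr0.
rewrite -addrA -big_split; congr (_ + _).
  by rewrite /kept !coord0 addn0 mulSn exprD.
apply: eq_bigr => k _; rewrite /= /bump leq0n add1n subSS.
by rewrite coordS ?leq_ord // rmorphD !mulrDl addrC.
Qed.

End NormalOrder.

(** * The normal form in the q-meromorphic Weyl algebra *)

Lemma rel_proj_surj (A : nzRingType) (r : A) (u : rel_quot r) :
  exists p, u = rel_proj r p.
Proof.
by exists (generic_quotient.repr u); rewrite /rel_proj generic_quotient.reprK.
Qed.

Lemma rel_proj_relator (A : nzRingType) (r : A) : rel_proj r r = 0.
Proof.
apply/eqP; rewrite -(rmorph0 (rel_proj r)) rel_projE subr0.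
by apply/ideal_genP; exists [:: (1, 1)]; rewrite big_seq1 mul1r mulr1.
Qed.

Lemma rmorph_relator (A B : pzRingType) (f : {rmorphism A -> B}) (X Y Q : A) :
  f (Y * X - Q * (X * Y) - X ^+ 2) =
  f Y * f X - f Q * (f X * f Y) - f X ^+ 2.
Proof. by rewrite !(rmorphB, rmorphM, rmorphXn). Qed.

Lemma map_natr_comm (A : nzRingType) (c : {poly nat}) (p : {poly A}) :
  map_poly (GRing.natmul 1) c * p = p * map_poly (GRing.natmul 1) c.
Proof.
elim/poly_ind: c => [|c n IHc]; first by rewrite rmorph0 mul0r mulr0.
rewrite rmorphD rmorphM /= map_polyX map_polyC /= rmorph_nat mulrDl mulrDr.
rewrite -mulrA -(commr_polyX p) !mulrA IHc; congr (_ + _).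
exact/esym/commr_nat.
Qed.

Lemma mw_coef_comm (R : realType) c (u : rel_quot (mw_relator R)) :
  mw_coef R c * u = u * mw_coef R c.
Proof.
have [p ->] := rel_proj_surj u.
by rewrite /mw_coef -!(rmorphM (rel_proj _)) map_natr_comm.
Qed.

Lemma mw_coefX (R : realType) : mw_coef R 'X = rel_proj (mw_relator R) 'X.
Proof. by congr (rel_proj _ _); apply: (map_polyX (GRing.natmul 1)). Qed.

Lemma mw_yx (R : realType) :
  mw_y R * mw_x R = mw_coef R 'X * (mw_x R * mw_y R) + mw_x R ^+ 2.
Proof.
have : rel_proj (mw_relator R) (mw_relator R) =
       mw_y R * mw_x R - mw_coef R 'X * (mw_x R * mw_y R) - mw_x R ^+ 2.
  by rewrite mw_coefX; exact: (rmorph_relator (rel_proj (mw_relator R))).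
rewrite rel_proj_relator => /esym/eqP.
by rewrite -addrA -opprD subr_eq0 => /eqP.
Qed.

Lemma normal_coords_coord (R : realType) a b : normal_coords R a b (coord a b).
Proof.
pose coef : {rmorphism {poly nat} -> rel_quot (mw_relator R)} :=
  rel_proj (mw_relator R) \o map_poly (GRing.natmul 1).
exact: (@mul_yn_xn _ coef _ _ (@mw_coef_comm R) (mw_yx R)).
Qed.

(** * The universal property of the q-meromorphic Weyl algebra *)

Section Lift.
Variables (R : realType) (S : nzRingType) (f : {rmorphism R[i] -> S}).
Variables u v t : S.
Hypothesis f_central : forall c s, GRing.comm (f c) s.
Hypothesis t_central : forall s, GRing.comm t s.
Hypothesis relation_uv : v * u = t * (u * v) + u ^+ 2.

Let word (m : {fmonom bool}) : S :=
  \prod_(e <- (m : seq bool)) (if e then v else u).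

Fact word_is_mmorphism : mmorphism word.
Proof.
split=> [m1 m2|]; last by rewrite /word fm1 big_nil.
by rewrite /word fmM big_cat.
Qed.

HB.instance Definition _ :=
  isMultiplicative.Build {fmonom bool} S word word_is_mmorphism.

Let subst : free_alg R -> S := mmap f word.

Fact subst_is_monoid_morphism : monoid_morphism subst.
Proof.
have [substM subst1] : GRing.multiplicative (mmap f word : free_alg R -> S).
  by apply: commr_mmap_is_multiplicative => *; apply: f_central.
by split.
Qed.

HB.instance Definition _ := GRing.isZmodMorphism.Build (free_alg R) S subst
  (mmap_is_additive (f := f) (h := word)).
HB.instance Definition _ := GRing.isMonoidMorphism.Build (free_alg R) S subst
  subst_is_monoid_morphism.

(** A ring S over C containing a central t and elements u, v with
    v u = t u v + u^2 receives the algebra, q, x, y going to t, u, v.  The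
    morphism is given on C<x, y>[q] together with its compatibility with the
    quotient. *)
Lemma mw_universal : exists phi : {rmorphism {poly free_alg R} -> S},
  [/\ phi 'X = t, phi (free_x R)%:P = u, phi (free_y R)%:P = v &
      forall p p', rel_proj (mw_relator R) p = rel_proj (mw_relator R) p' ->
        phi p = phi p'].
Proof.
have cft : commr_rmorph subst t by move=> s; apply: t_central.
pose phi : {rmorphism {poly free_alg R} -> S} := horner_morph cft.
have phiX : phi 'X = t by apply: horner_morphX.
have phi_letter e :
    phi (mkmalgU (fmu e) 1 : free_alg R)%:P = if e then v else u.
  rewrite [LHS]horner_morphC; transitivity (f 1 * word (fmu e)).
    exact: (mmapU (f := f) (h := word)).
  by rewrite rmorph1 mul1r /word fmU big_seq1.
have phix := phi_letter false; have phiy := phi_letter true.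
exists phi; split=> // p p' /eqP; rewrite rel_projE => /ideal_genP[s e].
have phi0 : phi (mw_relator R) = 0.
  transitivity (v * u - t * (u * v) - u ^+ 2).
    by rewrite -phiX -phix -phiy; exact: (rmorph_relator phi).
  by rewrite relation_uv -addrA -opprD subrr.
apply/eqP; rewrite -subr_eq0 -rmorphB e rmorph_sum big1 // => w _.
by rewrite !rmorphM phi0 mulr0 mul0r.
Qed.

End Lift.

(** * Linear independence of the normally ordered monomials *)

Section Shifts.
Variables (D : idomainType) (q : D).
Hypothesis q_neq0 : q != 0.

(** The q-integer [s + n] as a polynomial in the variable z = [s]; in closed
    form it is q^n z + [n]. *)
Definition shifted_qint (n : nat) : {poly D} :=
  iter n (fun p => q%:P * p + 1) 'X.

Definition shifted_qrising (n : nat) : {poly D} := \prod_(i < n) shifted_qint i.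

Lemma size_shifted_qint n : size (shifted_qint n) = 2%N.
Proof.
elim: n => [|n IHn] /=; first exact: size_polyX.
by rewrite size_polyDl mul_polyC size_scale // IHn ?size_poly1.
Qed.

Lemma size_shifted_qrising n : size (shifted_qrising n) = n.+1.
Proof.
elim: n => [|n IHn]; first by rewrite /shifted_qrising big_ord0 size_poly1.
rewrite /shifted_qrising big_ord_recr size_mul /=;
  rewrite -?size_poly_eq0 ?IHn ?size_shifted_qint //.
by rewrite addn2.
Qed.

Variable N : nat.

(** The basis vector e_n for n <= N, and 0 for n > N: the weighted shifts then
    send each e_n to a multiple of e_(n+1) with no exception at the cut-off. *)
Definition ket (n : nat) : 'cV[{poly D}]_N.+1 := \col_i (i == n :> nat)%:R.

Definition shift (w : nat -> {poly D}) : 'M[{poly D}]_N.+1 :=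
  \matrix_(i, j) (w j *+ (i == j.+1 :> nat)).

Lemma mul_ket (A : 'M[{poly D}]_N.+1) (j : 'I_N.+1) : A *m ket j = col j A.
Proof.
apply/colP=> i; rewrite !mxE (bigD1 j) //= big1 => [|l /negbTE lj].
  by rewrite mxE eqxx mulr1 addr0.
by rewrite mxE val_eqE lj mulr0.
Qed.

Lemma ket_inj (A B : 'M[{poly D}]_N.+1) :
  (forall n, A *m ket n = B *m ket n) -> A = B.
Proof.
move=> eqAB; apply/matrixP=> i j; have /colP/(_ i) := eqAB j.
by rewrite !mul_ket !mxE.
Qed.

Lemma ket_gt n : (N < n)%N -> ket n = 0.
Proof.
move=> lt_Nn; apply/colP=> i; rewrite !mxE.
by case: eqP => // e; move: (ltn_ord i); rewrite e ltnS leqNgt lt_Nn.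
Qed.

Lemma shift_ket w n : shift w *m ket n = w n *: ket n.+1.
Proof.
have [le_nN | lt_Nn] := leqP n N; last first.
  by rewrite (ket_gt lt_Nn) (ket_gt (leqW lt_Nn)) mulmx0 scaler0.
rewrite (mul_ket _ (Ordinal (le_nN : n < N.+1)%N)); apply/colP=> i.
by rewrite !mxE mulr_natr.
Qed.

Definition xmat := shift (fun=> 1).
Definition ymat := shift shifted_qint.

Lemma xmat_ket n m : xmat ^+ m *m ket n = ket (n + m).
Proof.
elim: m => [|m IHm]; first by rewrite expr0 mul1mx addn0.
by rewrite exprS -mulmxA IHm shift_ket scale1r addnS.
Qed.

Lemma ymat_ket m : ymat ^+ m *m ket 0 = shifted_qrising m *: ket m.
Proof.
elim: m => [|m IHm].
  by rewrite expr0 mul1mx /shifted_qrising big_ord0 scale1r.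
rewrite exprS -mulmxA IHm -scalemxAr shift_ket scalerA /shifted_qrising.
by rewrite [in RHS]big_ord_recr.
Qed.

(** On e_n both sides are multiples of e_(n+2), with coefficients [s+n+1] and
    q [s+n] + 1. *)
Lemma ymat_xmat :
  ymat * xmat = (q%:P)%:M * (xmat * ymat) + xmat ^+ 2 :> 'M_N.+1.
Proof.
apply: ket_inj => n; rewrite mulmxDl xmat_ket -!mulmxE -!mulmxA.
rewrite !(shift_ket, =^~ scalemxAr) mul_scalar_mx !scale1r /= scalerA.
by rewrite addn2 scalerDl scale1r mulrC.
Qed.

End Shifts.

(** The top summand is the only one that reaches degree n - 1. *)
Lemma lin_indep_by_size (D : idomainType) (p : nat -> {poly D}) :
  (forall i, size (p i) = i.+1) ->
  forall n (c d : nat -> D),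
    \sum_(i < n) c i *: p i = \sum_(i < n) d i *: p i ->
  forall i, (i < n)%N -> c i = d i.
Proof.
move=> size_p; elim=> // n IHn c d; rewrite !big_ord_recr /= => e.
have coef_low (b : nat -> D) : (\sum_(i < n) b i *: p i)`_n = 0.
  rewrite coef_sum big1 // => i _; rewrite coefZ nth_default ?mulr0 //.
  by rewrite size_p.
have lead_p : (p n)`_n != 0.
  have := lead_coef_eq0 (p n); rewrite lead_coefE size_p -size_poly_eq0 size_p.
  by move=> ->.
have cd_n : c n = d n.
  apply: (mulIf lead_p); have := congr1 (fun r : {poly D} => r`_n) e.
  by rewrite /= !coefD !coef_low !add0r !coefZ.
move=> i; rewrite ltnS leq_eqVlt => /orP[/eqP-> // | ]; apply: IHn.
by move: e; rewrite cd_n => /addIr.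
Qed.

(** Both expansions of y^a x^b have the same image in the matrices of size
    a + b + 1.  The summand x^(b+k) y^(a-k) sends e_0 to the multiple of e_(a+b)
    by a polynomial of degree a - k in z, so the coefficients can be compared
    degree by degree; they return to N[q] because N[q] embeds in C[q]. *)
Lemma normal_coords_inj (R : realType) a b c d :
  normal_coords R a b c -> normal_coords R a b d ->
  forall k, (k <= a)%N -> c k = d k.
Proof.
pose q : {poly R[i]} := 'X.
have q_neq0 : q != 0 by rewrite polyX_eq0.
pose N := (a + b)%N; pose S : nzRingType := 'M[{poly {poly R[i]}}]_N.+1.
pose f : {rmorphism R[i] -> S} := @scalar_mx _ N.+1 \o polyC \o polyC.
have scalarC (r : {poly {poly R[i]}}) (s : S) : GRing.comm (r%:M : S) s.
  exact: (esym (scalar_mxC r (s : 'M_N.+1))).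
have [phi [phiX phix phiy phi_rel]] := 
  @mw_universal R S f (xmat _ N) (ymat q N) (q%:P)%:M
    (fun r => scalarC r%:P%:P) (scalarC q%:P) (ymat_xmat q N).
pose iota : {poly nat} -> {poly R[i]} := map_poly (GRing.natmul 1).
have iota_inj : injective iota.
  move=> g h /polyP e; apply/polyP=> i; have /eqP := e i.
  by rewrite !coef_map /= Num.Theory.eqr_nat => /eqP.
pose lift (g : {poly nat}) : {poly free_alg R} := map_poly (GRing.natmul 1) g.
have phi_coef g : phi (lift g) = (iota g)%:P%:M.
  elim/poly_ind: g => [|g n IHg]; first by rewrite /lift /iota !rmorph0.
  by rewrite /lift /iota !rmorphD !rmorphM /= -/(lift g) -/(iota g) IHg
     !map_polyX phiX !map_polyC /= !rmorph_nat.
pose word (g : nat -> {poly nat}) : {poly free_alg R} :=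
  \sum_(k < a.+1)
    lift (g k) * (free_x R)%:P ^+ (b + k) * (free_y R)%:P ^+ (a - k).
have word_mw g : rel_proj (mw_relator R) (word g) =
    \sum_(k < a.+1) mw_coef R (g k) * mw_x R ^+ (b + k) * mw_y R ^+ (a - k).
  rewrite (rmorph_sum (rel_proj _)); apply: eq_bigr => k _.
  by rewrite 2!(rmorphM (rel_proj _)) 2!(rmorphXn (rel_proj _)).
(* The index is reversed, i = a - k, so that i is the degree in z. *)
have word_ket g : phi (word g) *m ket _ N 0 =
    (\sum_(i < a.+1) iota (g (a - i)%N) *: shifted_qrising q i) *: ket _ N N.
  rewrite rmorph_sum mulmx_suml scaler_suml (reindex_inj rev_ord_inj) /=.
  apply: eq_bigr => i _; rewrite !rmorphM !rmorphXn phix phiy phi_coef /= subSS.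
  rewrite -!mulmxE -!mulmxA ymat_ket -scalemxAr xmat_ket mul_scalar_mx.
  rewrite subKn ?leq_ord // scalerA mul_polyC.
  by rewrite addnCA subnKC ?leq_ord // addnC.
move=> Hc Hd k le_ka.
have eq_ket : phi (word c) *m ket _ N 0 = phi (word d) *m ket _ N 0.
  by congr (_ *m _); apply: phi_rel; rewrite !word_mw -Hc -Hd.
have/colP/(_ ord_max) := eq_ket; rewrite !word_ket !mxE eqxx !mulr1.
move=> e; apply: iota_inj.
have /(_ (a - k)%N) := lin_indep_by_size (size_shifted_qrising q_neq0)
  (c := fun i => iota (c (a - i)%N)) (d := fun i => iota (d (a - i)%N)) e.
by rewrite subKn // ltnS leq_subr; apply.
Qed.

Theorem theorem11 (R : realType) (a b : nat) (b_gt0 : (0 < b)%N) :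
  (exists c : nat -> {poly nat}, normal_coords R a b c) /\
  (forall c : nat -> {poly nat}, normal_coords R a b c ->
   forall k : nat, (k <= a)%N ->
     c k = wcard (ksubsets a k) (weight b k) /\
     c k = qrising b k * 'X^((a - k) * b) *
           \sum_(A in ksubsets a k) 'X^(qexponent A)).
Proof.
split=> [|c c_coords k le_ka].
  by exists (coord a b); apply: normal_coords_coord.
rewrite (normal_coords_inj c_coords (normal_coords_coord R a b) le_ka).
by split=> //; rewrite /coord /subset_gf mulr_sumr.
Qed.
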